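(* Every element $\mathbf x$ of the affine Weyl semigroup $W^+$ has only finitely many covers for the affine Bruhat order.
   Context: Kac–Moody root datum $(A,X,Y,(\alpha_i)_{i\in I},(\alpha_i^\vee)_{i\in I})$: generalized Cartan matrix $A$, free $\mathbb Z$-modules $X,Y$ of finite rank with perfect pairing $\langle\cdot,\cdot\rangle:Y\times X\to\mathbb Z$, linearly independent $(\alpha_i)\subset X$, $(\alpha_i^\vee)\subset Y$, $\langle\alpha_i^\vee,\alpha_j\rangle=a_{i,j}$; simple reflections $r_i(x)=x-\langle\alpha_i^\vee,x\rangle\alpha_i$, $r_i(y)=y-\langle y,\alpha_i\rangle\alpha_i^\vee$; $W^v=\langle r_i\rangle$; $\Phi=W^v\{\alpha_i\}$, $\Phi_+=\Phi\cap\bigoplus\mathbb Z_{\ge0}\alpha_i$; coroot $\gamma^\vee=w(\alpha_i^\vee)$ and $s_\gamma=wr_iw^{-1}$ for $\gamma=w(\alpha_i)$. $Y^{++}=\{\lambda\in Y\mid\langle\lambda,\alpha_i\rangle\ge0\ \forall i\}$, $Y^+=W^v\cdot Y^{++}$ (integral Tits cone). $Y\rtimes W^v$ has elements written $\varpi^\lambda w$ with product $\varpi^\lambda w\cdot\varpi^\mu v=\varpi^{\lambda+w(\mu)}wv$; $W^+=\{\varpi^\lambda w\mid\lambda\in Y^+,w\in W^v\}$ is a sub-semigroup. Affine roots $\Phi^a=\Phi\times\mathbb Z$; $(\gamma,m)$ is positive if $m>0$, or $m=0$ and $\gamma\in\Phi_+$; $\Phi^a_+$ denotes the positive ones. $Y\rtimes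 W^v$ acts on $\Phi^a$ by $\varpi^\lambda w\cdot(\gamma,m)=(w\gamma,m+\langle\lambda,w\gamma\rangle)$. For $a=(\gamma,m)\in\Phi^a$ set $s_a=\varpi^{m\gamma^\vee}s_\gamma$. Affine Bruhat order on $W^+$: for $\mathbf x\in W^+$ and $a\in\Phi^a_+$ with $\mathbf x^{-1}(a)\notin\Phi^a_+$, declare $s_a\mathbf x<\mathbf x$ (then $s_a\mathbf x\in W^+$); the affine Bruhat order $\le$ is the reflexive–transitive closure of these relations, which is a partial order. $\mathbf y$ covers $\mathbf x$ if $\mathbf x<\mathbf y$ and there is no $\mathbf z$ with $\mathbf x<\mathbf z<\mathbf y$; then $\mathbf x$ is called a co-cover of $\mathbf y$. *)

(* Defs.v *)
From HB Require Import structures.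
From mathcomp Require Import all_boot all_order all_algebra.
From Stdlib Require Import Relation_Operators.
Set Implicit Arguments. Unset Strict Implicit. Unset Printing Implicit Defensive.
Import Order.TTheory GRing.Theory Num.Theory.
Local Open Scope ring_scope.

(* X = Y = Z^d (row vectors) with the standard perfect pairing
   <y, x> = sum_k y_k x_k.  Every perfect pairing of free Z-modules of
   finite rank is isomorphic to this one (dual bases). *)
Definition pairing (d : nat) (y x : 'rV[int]_d) : int := (y *m x^T) 0 0.

Record KMRootDatum := {
  kmI : finType;
  kmd : nat;
  kmA : kmI -> kmI -> int;
  kmalpha : kmI -> 'rV[int]_kmd;
  kmalphav : kmI -> 'rV[int]_kmd;
  kmA_diag : forall i, kmA i i = 2;
  kmA_offdiag : forall i j, i != j -> kmA i j <= 0;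
  kmA_zero : forall i j, (kmA i j == 0) = (kmA j i == 0);
  km_pairing : forall i j, pairing (kmalphav i) (kmalpha j) = kmA i j;
  kmalpha_free : forall c : kmI -> int,
      \sum_i c i *: kmalpha i = 0 -> forall i, c i = 0;
  kmalphav_free : forall c : kmI -> int,
      \sum_i c i *: kmalphav i = 0 -> forall i, c i = 0
}.

Section AffineBruhat.
Variable D : KMRootDatum.
Local Notation I := (kmI D).
Local Notation d := (kmd D).
Local Notation alpha := (@kmalpha D).
Local Notation alphav := (@kmalphav D).

(* simple reflections, acting on row vectors by right multiplication *)
(* r_i(x) = x - <alpha_i^v, x> alpha_i *)
Definition Rx (i : I) : 'M[int]_d := 1%:M - (alphav i)^T *m alpha i.
(* r_i(y) = y - <y, alpha_i> alpha_i^v *)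
Definition Ry (i : I) : 'M[int]_d := 1%:M - (alpha i)^T *m alphav i.

(* An element w of W^v is recorded by its actions on Y and on X. *)
Definition Wt := ('M[int]_d * 'M[int]_d)%type.
Definition actY (w : Wt) (y : 'rV[int]_d) := y *m w.1.
Definition actX (w : Wt) (x : 'rV[int]_d) := x *m w.2.
(* composition w v (first v, then w) *)
Definition Wmul (w v : Wt) : Wt := (v.1 *m w.1, v.2 *m w.2).
Definition Winv (w : Wt) : Wt := (invmx w.1, invmx w.2).

(* W^v = the group generated by the r_i (the monoid they generate, as
   the r_i are involutions). *)
Inductive in_Wv : Wt -> Prop :=
| Wv1 : in_Wv (1%:M, 1%:M)
| WvS (i : I) (w : Wt) : in_Wv w -> in_Wv (Wmul (Ry i, Rx i) w).

Definition root_coroot (g : 'rV[int]_d) (gv : 'rV[int]_d) : Prop :=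
  exists (w : Wt) (i : I), in_Wv w /\ g = actX w (alpha i) /\ gv = actY w (alphav i).
Definition is_root (g : 'rV[int]_d) : Prop :=
  exists (w : Wt) (i : I), in_Wv w /\ g = actX w (alpha i).
Definition pos_root (g : 'rV[int]_d) : Prop :=
  is_root g /\ exists c : I -> nat, g = \sum_i (c i)%:Z *: alpha i.

(* reflection s_gamma : y |-> y - <y,gamma> gamma^v, x |-> x - <gamma^v,x> gamma *)
Definition refl (g gv : 'rV[int]_d) : Wt :=
  (1%:M - g^T *m gv, 1%:M - gv^T *m g).

Definition Ypp (l : 'rV[int]_d) : Prop := forall i, 0 <= pairing l (alpha i).
Definition Yplus (l : 'rV[int]_d) : Prop :=
  exists (w : Wt) (mu : 'rV[int]_d), in_Wv w /\ Ypp mu /\ l = actY w mu.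

(* Y \rtimes W^v : pairs (lambda, w) standing for varpi^lambda w *)
Definition Et := ('rV[int]_d * Wt)%type.
Definition Emul (x y : Et) : Et := (x.1 + actY x.2 y.1, Wmul x.2 y.2).
Definition Einv (x : Et) : Et := (- actY (Winv x.2) x.1, Winv x.2).
Definition in_Wplus (x : Et) : Prop := Yplus x.1 /\ in_Wv x.2.

Definition aroot := ('rV[int]_d * int)%type.
Definition pos_aroot (a : aroot) : Prop :=
  is_root a.1 /\ (0 < a.2 \/ (a.2 = 0 /\ pos_root a.1)).
Definition Eact (x : Et) (a : aroot) : aroot :=
  (actX x.2 a.1, a.2 + pairing x.1 (actX x.2 a.1)).
Definition s_aff (a : aroot) (gv : 'rV[int]_d) : Et := (a.2 *: gv, refl a.1 gv).

(* generating relations: bstep y x means y = s_a x < x *)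
Definition bstep (y x : Et) : Prop :=
  in_Wplus x /\
  exists (a : aroot) (gv : 'rV[int]_d),
    pos_aroot a /\ root_coroot a.1 gv /\
    ~ pos_aroot (Eact (Einv x) a) /\ y = Emul (s_aff a gv) x.

Definition bruhat_le (x y : Et) : Prop := clos_refl_trans Et bstep x y.
Definition bruhat_lt (x y : Et) : Prop := bruhat_le x y /\ x <> y.
Definition covers (y x : Et) : Prop :=
  bruhat_lt x y /\ ~ (exists z, bruhat_lt x z /\ bruhat_lt z y).

End AffineBruhat.

(* Main.v *)
(* Write x = u varpi^mu and let y = u s_b varpi^(mu + m b^v) be an upper neighbour
   of x in one reflection step.  If y has a right descent by a simple reflection
   r_i, the lifting property forces y = x r_i, or y r_i covers x r_i with x r_i < x,
   and one inducts on the finite number of positive roots g with x(g,0) negative.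
   Otherwise mu + m b^v is dominant and b may be taken positive.  The dihedral
   group of s_b bounds m, and m = 1, <mu,b> >= 0 for all but finitely many b.
   Among the remaining b, Dickson's lemma applied to the coordinates of b and of
   mu + b^v gives g <= b with b^v - g^v dominant, so that <b^v,g> >= 2 and
   <g^v,b> <= 2; then the reflections along g, s_g b, g produce a chain strictly
   between x and y, unless <mu,b> < 2<mu,g> + 2.  Finally, comparable b and g with
   <mu,b> = <mu,g> would satisfy <b^v,g> = <g^v,b> = 2, so that all g - 2n(b - g)
   are roots, g <= 2n(b - g) for large n, and the dominant mu + g^v, which
   annihilates b - g, would annihilate g. *)
Require Import Defs.
From HB Require Import structures.
From mathcomp Require Import all_boot all_order all_algebra.
From mathcomp Require Import zify ring.
From Stdlib Require Import Relation_Operators Operators_Properties Classical.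
Set Implicit Arguments. Unset Strict Implicit. Unset Printing Implicit Defensive.
Import Order.TTheory GRing.Theory Num.Theory.
Local Open Scope ring_scope.

Ltac vring := by apply/rowP => ?; rewrite !mxE; ring.

(** * Bilinearity of the pairing *)

Section Pairing.
Variable d : nat.
Implicit Types x y : 'rV[int]_d.

Lemma pairingDl y y' x : pairing (y + y') x = pairing y x + pairing y' x.
Proof. by rewrite /pairing mulmxDl mxE. Qed.

Lemma pairingDr y x x' : pairing y (x + x') = pairing y x + pairing y x'.
Proof. by rewrite /pairing linearD mulmxDr mxE. Qed.

Lemma pairingZl c y x : pairing (c *: y) x = c * pairing y x.
Proof. by rewrite /pairing -scalemxAl mxE. Qed.

Lemma pairingZr c y x : pairing y (c *: x) = c * pairing y x.
Proof. by rewrite /pairing linearZ -scalemxAr mxE. Qed.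

Lemma pairingNl y x : pairing (- y) x = - pairing y x.
Proof. by rewrite -scaleN1r pairingZl mulN1r. Qed.

Lemma pairingNr y x : pairing y (- x) = - pairing y x.
Proof. by rewrite -scaleN1r pairingZr mulN1r. Qed.

Lemma pairing0r y : pairing y 0 = 0.
Proof. by rewrite /pairing trmx0 mulmx0 mxE. Qed.

Lemma pairing_sumr (I : finType) (F : I -> 'rV[int]_d) y :
  pairing y (\sum_i F i) = \sum_i pairing y (F i).
Proof.
by apply: (big_morph (pairing y)); [exact: pairingDr | exact: pairing0r].
Qed.

Lemma row_pairing y x : y *m x^T = (pairing y x)%:M.
Proof. by apply/matrixP=> i j; rewrite !ord1 [RHS]mxE. Qed.

Lemma pairing_trmx y x : x *m y^T = (pairing y x)%:M.
Proof. by rewrite -[LHS]trmxK trmx_mul trmxK row_pairing tr_scalar_mx. Qed.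

End Pairing.

Definition pairingE := (pairingDl, pairingDr, pairingZl, pairingZr, pairingNl, pairingNr).

Lemma reflK n (a : int) (x v : 'rV[int]_n) :
  x - a *: v - (a - a * 2) *: v = x.
Proof.
rewrite -addrA -opprD -scalerDl.
have -> : a + (a - a * 2) = 0 by ring.
by rewrite scale0r subr0.
Qed.

(** * Coordinates of a simple root under alternating products of two simple reflections *)

Fixpoint alt_coef (A B : int) (k : nat) : int * int :=
  if k is k'.+1 then
    let: (p, q) := alt_coef A B k' in
    if odd k' then (A * q - p, q) else (p, B * p - q)
  else (1, 0).

(** With A = -a_ij and B = -a_ji, the pair holds the coordinates of an alternating product applied
    to alpha_i. Nonnegativity alone is not inductive. The third clause says that the coordinate
    changed last is at least half of what would make the next reflection vanish; with A B >= 4 this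
    is inherited by the other coordinate. *)
Lemma alt_coef_ge4 (A B : int) k :
  0 <= A -> 0 <= B -> 4 <= A * B ->
  let: (p, q) := alt_coef A B k in
  [/\ 0 <= p, 0 <= q & if odd k then B * p <= q * 2 else A * q <= p * 2].
Proof.
move=> A0 B0 AB; elim: k => [|k /=]; first by split=> //; rewrite mulr0.
case: (alt_coef A B k) => p q; case: (odd k) => /= -[p0 q0 h]; split; nia.
Qed.

(* The order of [r_i r_j] when [a_ij = -A], [a_ji = -B] and [A * B < 4]. *)
Definition cox (A B : int) : nat :=
  if A * B == 0 then 2 else if A * B == 1 then 3 else if A * B == 2 then 4
  else 6.

Lemma small_product (A B : int) : 0 <= A -> 0 <= B -> (A == 0) = (B == 0) ->
  A * B < 4 ->
  (A, B) \in [:: (0, 0); (1, 1); (1, 2); (2, 1); (1, 3); (3, 1)].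
Proof.
move=> A0 B0; have [->|A1] := eqVneq A 0.
  by move=> /esym/eqP->.
have [->|B1] := eqVneq B 0; first by [].
move=> _ AB; have A4 : A < 4 by nia.
have B4 : B < 4 by nia.
case: A A0 A1 AB A4 => // [[|[|[|[|?]]]]] // _ _; case: B B0 B1 B4 => // [[|[|[|[|?]]]]] //.
Qed.

Lemma alt_coef_lt4 (A B : int) k : 0 <= A -> 0 <= B -> (A == 0) = (B == 0) ->
  A * B < 4 -> (k < cox A B)%N ->
  let: (p, q) := alt_coef A B k in 0 <= p /\ 0 <= q.
Proof.
move=> A0 B0 z AB; move: (small_product A0 B0 z AB); rewrite !inE.
by do 5?[case/orP]; move=> /eqP[-> ->];
  case: k => [|[|[|[|[|[|?]]]]]].
Qed.

(** * Predicates contained in a finite list *)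

Section Finite.
Variables (T : eqType).
Implicit Types Q : T -> Prop.

Definition finite_pred Q := exists s : seq T, forall y, Q y -> y \in s.

Lemma finite_sub Q Q' : (forall y, Q y -> Q' y) -> finite_pred Q' -> finite_pred Q.
Proof. by move=> h [s hs]; exists s => y /h/hs. Qed.

Lemma finiteU Q Q' : finite_pred Q -> finite_pred Q' -> finite_pred (fun y => Q y \/ Q' y).
Proof.
move=> [s hs] [t ht]; exists (s ++ t) => y; rewrite mem_cat.
by case=> [/hs->|/ht->]; rewrite ?orbT.
Qed.

Lemma finite0 Q : (forall y, ~ Q y) -> finite_pred Q.
Proof. by move=> h; exists [::] => y /h. Qed.

Lemma finite1 a : finite_pred (fun y => y = a).
Proof. by exists [:: a] => y ->; rewrite inE. Qed.

Lemma finite_bigU (K : eqType) (ks : seq K) (Q : K -> T -> Prop) :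
  (forall k, k \in ks -> finite_pred (Q k)) ->
  finite_pred (fun y => exists2 k, k \in ks & Q k y).
Proof.
elim: ks => [|k ks IH] h; first by apply: finite0 => y [].
apply: finite_sub (finiteU (h k _) (IH _)); rewrite ?inE ?eqxx //; last first.
  by move=> k' h'; apply: h; rewrite inE h' orbT.
by move=> y [k']; rewrite inE => /orP[/eqP->|hk]; [left | right; exists k'].
Qed.

End Finite.

Lemma finite_image (T T' : eqType) (f : T -> T') (Q : T -> Prop) (Q' : T' -> Prop) :
  (forall y, Q' y -> exists2 x, Q x & y = f x) -> finite_pred Q -> finite_pred Q'.
Proof.
move=> h [s hs]; exists (map f s) => y /h[x /hs xs ->].
exact: map_f.
Qed.

(** * Dickson's lemma *)

Section Dickson.
Variables (T : eqType) (K : eqType) (f : T -> K -> nat).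

(** Induction on the coordinates. A base [B0] for the old coordinates serves every [t] whose new
    coordinate is at least the maximum over [B0]. Below that maximum there are finitely many levels,
    and on each the new coordinate is constant, so the induction hypothesis applies level by
    level. *)
Lemma dickson (ks : seq K) (P : T -> Prop) :
  exists B : seq T, (forall b, b \in B -> P b) /\
    forall t, P t -> exists2 b, b \in B & forall k, k \in ks -> (f b k <= f t k)%N.
Proof.
elim: ks P => [|k ks IH] P.
  have [[t0 h0]|no] := classic (exists t, P t); last first.
    by exists [::]; split=> // t ht; case: no; exists t.
  exists [:: t0]; split=> [b|t ht]; first by rewrite inE => /eqP->.
  by exists t0; rewrite ?inE.
have [B0 [B0P B0t]] := IH P.
have low M : exists B : seq T, (forall b, b \in B -> P b) /\
    forall t, P t -> (f t k < M)%N ->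
    exists2 b, b \in B & forall k', k' \in k :: ks -> (f b k' <= f t k')%N.
  elim: M => [|M [B [BP Bt]]]; first by exists [::].
  have [B' [BP' Bt']] := IH (fun t => P t /\ f t k = M).
  exists (B ++ B'); split=> [b|t ht].
    by rewrite mem_cat => /orP[/BP|/BP'[]].
  rewrite ltnS leq_eqVlt => /orP[/eqP e|lt].
    have [b hb le] := Bt' t (conj ht e); exists b; first by rewrite mem_cat hb orbT.
    by move=> k'; rewrite inE => /orP[/eqP->|/le//]; case: (BP' b hb) => _ ->; rewrite e.
  by have [b hb le] := Bt t ht lt; exists b; rewrite ?mem_cat ?hb.
have [B [BP Bt]] := low (\max_(b <- B0) f b k)%N.
exists (B0 ++ B); split=> [b|t ht]; first by rewrite mem_cat => /orP[/B0P|/BP].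
have [/(Bt t ht)[b hb le]|ge] := ltnP (f t k) (\max_(b <- B0) f b k).
  by exists b; rewrite ?mem_cat ?hb ?orbT.
have [b hb le] := B0t t ht; exists b; first by rewrite mem_cat hb.
move=> k'; rewrite inE => /orP[/eqP->|/le//]; apply: leq_trans ge.
by rewrite (big_rem b) //= leq_maxl.
Qed.

End Dickson.

(** * The action of the Weyl group on X and Y *)

Section Roots.
Variable D : KMRootDatum.
Local Notation I := (kmI D).
Local Notation d := (kmd D).
Local Notation V := 'rV[int]_d.
Local Notation alpha := (@kmalpha D).
Local Notation alphav := (@kmalphav D).
Local Notation Wt := (Wt D).
Local Notation in_Wv := (@in_Wv D).
Local Notation rt := (@root_coroot D).
Implicit Types (u v w : Wt) (x y g gv l mu nu : V) (i j : I) (s : seq I).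

Definition W1 : Wt := (1%:M, 1%:M).

Lemma actXD w x y : actX w (x + y) = actX w x + actX w y.
Proof. exact: mulmxDl. Qed.
Lemma actXZ w c x : actX w (c *: x) = c *: actX w x.
Proof. by rewrite /actX scalemxAl. Qed.
Lemma actXN w x : actX w (- x) = - actX w x.
Proof. exact: mulNmx. Qed.
Lemma actYD w x y : actY w (x + y) = actY w x + actY w y.
Proof. exact: mulmxDl. Qed.
Lemma actYZ w c x : actY w (c *: x) = c *: actY w x.
Proof. by rewrite /actY scalemxAl. Qed.
Lemma actYN w x : actY w (- x) = - actY w x.
Proof. exact: mulNmx. Qed.
Lemma actX_sum w (F : I -> V) : actX w (\sum_i F i) = \sum_i actX w (F i).
Proof. exact: mulmx_suml. Qed.
Lemma actXM w v x : actX (Wmul w v) x = actX w (actX v x).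
Proof. exact: mulmxA. Qed.
Lemma actYM w v x : actY (Wmul w v) x = actY w (actY v x).
Proof. exact: mulmxA. Qed.
Lemma actX1 x : actX W1 x = x.
Proof. exact: mulmx1. Qed.
Lemma actY1 x : actY W1 x = x.
Proof. exact: mulmx1. Qed.

Lemma Wt_ext w v :
  (forall x, actX w x = actX v x) -> (forall y, actY w y = actY v y) -> w = v.
Proof.
case: w v => [w1 w2] [v1 v2] hX hY.
by congr pair; apply/row_matrixP => k; rewrite !rowE; [exact: hY | exact: hX].
Qed.

Lemma WmulA u v w : Wmul u (Wmul v w) = Wmul (Wmul u v) w.
Proof. by rewrite /Wmul /= !mulmxA. Qed.
Lemma Wmul1 w : Wmul w W1 = w.
Proof. by rewrite /Wmul /= !mul1mx; case: w. Qed.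
Lemma W1mul w : Wmul W1 w = w.
Proof. by rewrite /Wmul /= !mulmx1; case: w. Qed.

Definition sr i : Wt := (Ry i, Rx i).

Lemma actX_refl g gv x : actX (refl g gv : Wt) x = x - pairing gv x *: g.
Proof. by rewrite /actX /= mulmxBr mulmx1 mulmxA pairing_trmx mul_scalar_mx. Qed.
Lemma actY_refl g gv y : actY (refl g gv : Wt) y = y - pairing y g *: gv.
Proof. by rewrite /actY /= mulmxBr mulmx1 mulmxA row_pairing mul_scalar_mx. Qed.
Lemma actX_sr i x : actX (sr i) x = x - pairing (alphav i) x *: alpha i.
Proof. exact: actX_refl. Qed.
Lemma actY_sr i y : actY (sr i) y = y - pairing y (alpha i) *: alphav i.
Proof. exact: actY_refl. Qed.

Lemma pair_diag i : pairing (alphav i) (alpha i) = 2.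
Proof. by rewrite km_pairing kmA_diag. Qed.

Lemma srK i : Wmul (sr i) (sr i) = W1.
Proof.
apply: Wt_ext => z; rewrite ?actXM ?actYM ?actX1 ?actY1.
  by rewrite !actX_sr !pairingE pair_diag reflK.
by rewrite !actY_sr !pairingE pair_diag reflK.
Qed.

Fixpoint wordW s : Wt := if s is i :: s' then Wmul (sr i) (wordW s') else W1.

Lemma wordW_cat s t : wordW (s ++ t) = Wmul (wordW s) (wordW t).
Proof. by elim: s => [|i s IH] /=; rewrite ?W1mul // IH WmulA. Qed.
Lemma wordW_rcons s i : wordW (rcons s i) = Wmul (wordW s) (sr i).
Proof. by rewrite -cats1 wordW_cat /= Wmul1. Qed.

Lemma in_WvP w : in_Wv w <-> exists s, w = wordW s.
Proof.
split; first by elim=> [|i v _ [s ->]]; [exists [::] | exists (i :: s)].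
by case=> s ->; elim: s => [|i s IH] /=; [exact: Wv1 | exact: WvS].
Qed.

Lemma in_WvM u v : in_Wv u -> in_Wv v -> in_Wv (Wmul u v).
Proof.
move=> /in_WvP[s ->] /in_WvP[t ->]; apply/in_WvP.
by exists (s ++ t); rewrite wordW_cat.
Qed.

Lemma in_Wv_sr i : in_Wv (sr i).
Proof. by apply/in_WvP; exists [:: i]; rewrite /= Wmul1. Qed.

Lemma wordW_rev s : Wmul (wordW s) (wordW (rev s)) = W1.
Proof.
elim: s => [|i s IH] /=; first exact: Wmul1.
by rewrite rev_cons wordW_rcons WmulA -(WmulA (sr i)) IH Wmul1 srK.
Qed.

Lemma Winv_wordW s : Winv (wordW s) = wordW (rev s).
Proof.
have [e1 e2] : (wordW (rev s)).1 *m (wordW s).1 = 1%:M /\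
    (wordW (rev s)).2 *m (wordW s).2 = 1%:M.
  by case: (wordW_rev s).
have inv_eq n (A B : 'M[int]_n) : A *m B = 1%:M -> invmx B = A.
  move=> AB; have [_ uB] := mulmx1_unit AB.
  by rewrite -[invmx B]mul1mx -AB -mulmxA mulmxV // mulmx1.
by rewrite /Winv (inv_eq _ _ _ e1) (inv_eq _ _ _ e2); case: (wordW (rev s)).
Qed.

Lemma in_Wv_inv w : in_Wv w -> in_Wv (Winv w).
Proof. by move=> /in_WvP[s ->]; apply/in_WvP; exists (rev s); exact: Winv_wordW. Qed.
Lemma WmulV w : in_Wv w -> Wmul w (Winv w) = W1.
Proof. by move=> /in_WvP[s ->]; rewrite Winv_wordW wordW_rev. Qed.
Lemma WmulVw w : in_Wv w -> Wmul (Winv w) w = W1.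
Proof.
by move=> /in_WvP[s ->]; rewrite Winv_wordW -{2}[s]revK wordW_rev.
Qed.
Lemma actXK w x : in_Wv w -> actX (Winv w) (actX w x) = x.
Proof. by move=> h; rewrite -actXM WmulVw // actX1. Qed.
Lemma actXVK w x : in_Wv w -> actX w (actX (Winv w) x) = x.
Proof. by move=> h; rewrite -actXM WmulV // actX1. Qed.
Lemma actYK w x : in_Wv w -> actY (Winv w) (actY w x) = x.
Proof. by move=> h; rewrite -actYM WmulVw // actY1. Qed.
Lemma actYVK w x : in_Wv w -> actY w (actY (Winv w) x) = x.
Proof. by move=> h; rewrite -actYM WmulV // actY1. Qed.

Lemma pair_act w y x : in_Wv w -> pairing (actY w y) (actX w x) = pairing y x.
Proof.
elim=> [|i v _ IH]; first by rewrite actY1 actX1.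
rewrite actXM actYM -/(sr i) actX_sr actY_sr !pairingE pair_diag IH; ring.
Qed.

(** * Positive cones; every root is positive or negative *)

Definition cone (e : I -> V) x := exists c : I -> nat, x = \sum_i (c i)%:Z *: e i.

Lemma coneD (e : I -> V) x y : cone e x -> cone e y -> cone e (x + y).
Proof.
move=> [b ->] [c ->]; exists (fun i => b i + c i)%N.
by rewrite -big_split; apply: eq_bigr => i _; rewrite PoszD scalerDl.
Qed.

Lemma coneZ (e : I -> V) (m : int) x : 0 <= m -> cone e x -> cone e (m *: x).
Proof.
case: m => // m _ [c ->]; exists (fun i => m * c i)%N.
by rewrite scaler_sumr; apply: eq_bigr => i _; rewrite PoszM scalerA.
Qed.

Lemma cone_basis (e : I -> V) i : cone e (e i).
Proof.
exists (fun j => (j == i : nat)); rewrite (bigD1 i) //= eqxx scale1r big1 ?addr0 //.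
by move=> j /negbTE->; rewrite scale0r.
Qed.

Lemma cone0 (e : I -> V) : cone e 0.
Proof. by exists (fun=> 0%N); rewrite big1 // => i _; rewrite scale0r. Qed.

Lemma cone_sum (e : I -> V) (c : I -> nat) (F : I -> V) :
  (forall i, (0 < c i)%N -> cone e (F i)) -> cone e (\sum_i (c i)%:Z *: F i).
Proof.
move=> h; apply: (big_ind (cone e)); [exact: cone0 | by move=> *; exact: coneD|].
move=> i _; case: (posnP (c i)) => [->|ci]; first by rewrite scale0r; exact: cone0.
by apply: coneZ => //; exact: h.
Qed.

(** Root and coroot are followed together, so that a single induction also shows that they have the
    same sign. *)
Definition wpos w i := cone alpha (actX w (alpha i)) /\ cone alphav (actY w (alphav i)).
Definition wneg w i :=
  cone alpha (- actX w (alpha i)) /\ cone alphav (- actY w (alphav i)).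

Fixpoint alt i j k : seq I :=
  if k is k'.+1 then (if odd k' then i else j) :: alt i j k' else [::].

Lemma alt_split i j k m : exists2 t, size t = k & alt i j (k + m) = t ++ alt i j m.
Proof.
elim: k => [|k [t st IH]]; first by exists [::].
by exists ((if odd (k + m) then i else j) :: t); rewrite ?addSn /= ?st // IH.
Qed.

Lemma actX_sr_comb i j p q x :
  actX (sr i) (x + p *: alpha i + q *: alpha j) =
    x + (- pairing (alphav i) x - p - kmA i j * q) *: alpha i + q *: alpha j /\
  actX (sr j) (x + p *: alpha i + q *: alpha j) =
    x + p *: alpha i + (- pairing (alphav j) x - q - kmA j i * p) *: alpha j.
Proof. by rewrite !actX_sr !pairingE !pair_diag !km_pairing; split; vring. Qed.

Lemma actY_sr_comb i j p q x :
  actY (sr i) (x + p *: alphav i + q *: alphav j) =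
    x + (- pairing x (alpha i) - p - kmA j i * q) *: alphav i + q *: alphav j /\
  actY (sr j) (x + p *: alphav i + q *: alphav j) =
    x + p *: alphav i + (- pairing x (alpha j) - q - kmA i j * p) *: alphav j.
Proof. by rewrite !actY_sr !pairingE !pair_diag !km_pairing; split; vring. Qed.

Lemma actX_alt i j k : let: (p, q) := alt_coef (- kmA i j) (- kmA j i) k in
  actX (wordW (alt i j k)) (alpha i) = p *: alpha i + q *: alpha j.
Proof.
elim: k => [|k /=]; first by rewrite actX1; vring.
case: (alt_coef _ _ k) => p q; case: (odd k); rewrite actXM => ->;
  rewrite actX_sr !pairingE pair_diag km_pairing; vring.
Qed.

Lemma actY_alt i j k : let: (p, q) := alt_coef (- kmA j i) (- kmA i j) k in
  actY (wordW (alt i j k)) (alphav i) = p *: alphav i + q *: alphav j.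
Proof.
elim: k => [|k /=]; first by rewrite actY1; vring.
case: (alt_coef _ _ k) => p q; case: (odd k); rewrite actYM => ->;
  rewrite actY_sr !pairingE pair_diag km_pairing; vring.
Qed.

(** Equality is needed on all of X and Y, not only on the rank two span. Both words send x to x + p
    alpha_i + q alpha_j with p and q linear in the two pairings with x, so each of the six finite
    types is a polynomial identity. *)
Lemma braid i j : i != j -> kmA i j * kmA j i < 4 ->
  wordW (alt i j (cox (- kmA i j) (- kmA j i))) =
  wordW (alt j i (cox (- kmA i j) (- kmA j i))).
Proof.
move=> ij AB.
have ji : j != i by rewrite eq_sym.
have A0 : 0 <= - kmA i j by rewrite oppr_ge0 kmA_offdiag.
have B0 : 0 <= - kmA j i by rewrite oppr_ge0 kmA_offdiag.
have z : (- kmA i j == 0) = (- kmA j i == 0) by rewrite !oppr_eq0 kmA_zero.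
have AB' : - kmA i j * - kmA j i < 4 by rewrite mulrNN.
have start n (x e f : 'rV[int]_n) : x = x + 0 *: e + 0 *: f by vring.
have xi p q x := (actX_sr_comb i j p q x).1.
have xj p q x := (actX_sr_comb i j p q x).2.
have yi p q x := (actY_sr_comb i j p q x).1.
have yj p q x := (actY_sr_comb i j p q x).2.
have finite_pred n (x e f : 'rV[int]_n) p q p' q' : p = p' -> q = q' ->
  x + p *: e + q *: f = x + p' *: e + q' *: f by move=> -> ->.
move: (small_product A0 B0 z AB'); rewrite !inE.
do 5?[case/orP]; move=> /eqP[eA eB]; rewrite eA eB /cox /=;
  move: eA eB => /(canRL opprK) eA /(canRL opprK) eB;
  (apply: Wt_ext => x;
   [rewrite [x](start _ _ (alpha i) (alpha j)) |
    rewrite [x](start _ _ (alphav i) (alphav j))];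
   rewrite ?(actXM, actYM) ?(actX1, actY1) ?(xi, xj, yi, yj) ?eA ?eB;
   apply: finite_pred; ring).
Qed.

Definition comb2 (e : I -> V) i j x :=
  exists p q : int, [/\ 0 <= p, 0 <= q & x = p *: e i + q *: e j].

(** If the dihedral group is infinite, or [k] is below its Coxeter order m, the coordinates are
    nonnegative. Otherwise the last m letters form a braid word, which can be rewritten to end in
    [i]; deleting that [i] leaves fewer than [k] letters. *)
Lemma rank_two i j k : i != j ->
  (comb2 alpha i j (actX (wordW (alt i j k)) (alpha i)) /\
   comb2 alphav i j (actY (wordW (alt i j k)) (alphav i))) \/
  exists2 t, (size t < k)%N & wordW (alt i j k) = wordW (rcons t i).
Proof.
move=> ij; have ji : j != i by rewrite eq_sym.
have A0 : 0 <= - kmA i j by rewrite oppr_ge0 kmA_offdiag.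
have B0 : 0 <= - kmA j i by rewrite oppr_ge0 kmA_offdiag.
have z : (- kmA i j == 0) = (- kmA j i == 0) by rewrite !oppr_eq0 kmA_zero.
have pos : (let: (p, q) := alt_coef (- kmA i j) (- kmA j i) k in 0 <= p /\ 0 <= q) ->
    (let: (p, q) := alt_coef (- kmA j i) (- kmA i j) k in 0 <= p /\ 0 <= q) ->
    comb2 alpha i j (actX (wordW (alt i j k)) (alpha i)) /\
    comb2 alphav i j (actY (wordW (alt i j k)) (alphav i)).
  move: (actX_alt i j k) (actY_alt i j k).
  case: (alt_coef _ _ k) => p q; case: (alt_coef _ _ k) => p' q' hX hY [p0 q0] [p0' q0'].
  by split; [exists p, q | exists p', q'].
have [AB|AB] := leP 4 (- kmA i j * - kmA j i).
  left; apply: pos; [have := alt_coef_ge4 k A0 B0 AB | have := alt_coef_ge4 k B0 A0 _];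
    case: (alt_coef _ _ k) => p q; first by case.
  by rewrite mulrC => /(_ AB)[].
have coxC : cox (- kmA j i) (- kmA i j) = cox (- kmA i j) (- kmA j i).
  by rewrite /cox mulrC.
have [km|mk] := ltnP k (cox (- kmA i j) (- kmA j i)).
  left; apply: pos; first exact: alt_coef_lt4.
  by apply: alt_coef_lt4; rewrite 1?mulrC ?coxC.
right; have [t st e] :=
  alt_split i j (k - cox (- kmA i j) (- kmA j i)) (cox (- kmA i j) (- kmA j i)).
rewrite subnK // in e.
have [s ss es] : exists2 s, (size s).+1 = cox (- kmA i j) (- kmA j i)
    & alt j i (cox (- kmA i j) (- kmA j i)) = rcons s i.
  rewrite /cox; do 3?[case: ifP => _]; by [exists [:: j] | exists [:: i; j]
    | exists [:: j; i; j] | exists [:: j; i; j; i; j]].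
exists (t ++ s); first by rewrite size_cat; lia.
rewrite e wordW_cat braid //; last by rewrite -mulrNN.
by rewrite es -wordW_cat rcons_cat.
Qed.

Lemma wpos_comb v t i j : wpos v i -> wpos v j ->
  comb2 alpha i j (actX t (alpha i)) -> comb2 alphav i j (actY t (alphav i)) ->
  wpos (Wmul v t) i.
Proof.
move=> [iX iY] [jX jY] [p [q [p0 q0 eX]]] [p' [q' [p0' q0' eY]]].
split; rewrite ?actXM ?actYM ?eX ?eY ?actXD ?actYD ?actXZ ?actYZ;
  by apply: coneD; apply: coneZ.
Qed.

(* Deodhar's argument: peel letters of the rank two subgroup off the end of
   the word until what remains is positive on both simple roots. *)
Lemma wpos_or_shorter s i :
  wpos (wordW s) i \/ exists2 t, (size t < size s)%N & wordW s = wordW (rcons t i).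
Proof.
have [n] := ubnP (size s); elim: n s i => // n IH s i.
case/lastP: s => [|s0 j]; first by left; split; rewrite ?actX1 ?actY1; exact: cone_basis.
rewrite size_rcons ltnS => sn.
have [->|ij] := eqVneq i j; first by right; exists s0; rewrite ?size_rcons.
have ji : j != i by rewrite eq_sym.
(* The last letter [j] starts an alternating suffix of length [k]. Each round shortens the prefix
   [v], and the total length never grows. *)
suff loop : forall (m : nat) (v : seq I) (k : nat), (size v < m)%N -> (0 < k)%N ->
    (size v + k <= (size s0).+1)%N ->
    wordW (rcons s0 j) = Wmul (wordW v) (wordW (alt i j k)) ->
    wpos (wordW (rcons s0 j)) i \/
    exists2 t, (size t < (size s0).+1)%N & wordW (rcons s0 j) = wordW (rcons t i).
  apply: (loop _ s0 1%N) => //; first by rewrite addn1.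
  by rewrite wordW_rcons /= Wmul1.
elim=> // m IHm v k vm k0 vk e.
have vn : (size v < n)%N by lia.
(* a letter not at the front of the alternating word can be moved onto it *)
pose c := if odd k then i else j.
have [vc|[t tv et]] := IH v c vn; last first.
  apply: (IHm t k.+1); [lia|by []|lia|].
  by rewrite e et wordW_rcons /= -/c WmulA.
case: k k0 vk e @c vc => // k _ vk e /= vc.
(* This is the front letter of the alternating word, so a prefix ending in it cancels against it. If
   nothing of the alternating word remains, the induction hypothesis is applied to the shorter
   prefix. *)
pose c' := if odd k then i else j.
have [vc'|[t tv et]] := IH v c' vn; last first.
  have e' : wordW (rcons s0 j) = Wmul (wordW t) (wordW (alt i j k)).
    by rewrite e et wordW_rcons /= -/c' -WmulA [Wmul (sr _) (Wmul _ _)]WmulA srK W1mul.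
  case: (posnP k) e' => [->|k0] e'; last by apply: (IHm t k) => //; lia.
  rewrite /= Wmul1 in e'.
  have [tp|[t' t't et']] := IH t i ltac:(lia); first by left; rewrite e'.
  by right; exists t'; [lia | rewrite e' et'].
have vij : wpos (wordW v) i /\ wpos (wordW v) j.
  by move: vc vc'; rewrite /c' /=; case: (odd k).
have [[tX tY]|[t tk et]] := rank_two k.+1 ij.
  by left; rewrite e; apply: wpos_comb tX tY; case: vij.
by right; exists (v ++ t); [rewrite size_cat; lia | rewrite e et rcons_cat wordW_cat].
Qed.

(** When [wpos_or_shorter] gives w = t s_i with [t] short, the sign of [w] at [i] is opposite to
    that of [t], which is known by induction on length. *)
Lemma wpos_or_neg w i : in_Wv w -> wpos w i \/ wneg w i.
Proof.
move=> /in_WvP[s ->]; have [n] := ubnP (size s); elim: n s => // n IH s sn.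
have [|[t ts ->]] := wpos_or_shorter s i; first by left.
rewrite wordW_rcons /wpos /wneg !actXM !actYM !actX_sr !actY_sr !pair_diag.
have e (m : nat) (x : 'rV[int]_m) : x - 2 *: x = - x by vring.
rewrite !e !actXN !actYN !opprK.
by have [|[]|[]] := IH t; [lia | right | left].
Qed.

(** * Roots, coroots and reflections *)

Lemma rt_root g gv : rt g gv -> @is_root D g.
Proof. by move=> [w [i [hw [-> _]]]]; exists w, i. Qed.

Lemma is_root_rt g : @is_root D g -> exists gv, rt g gv.
Proof. by move=> [w [i [hw ->]]]; exists (actY w (alphav i)), w, i. Qed.

Lemma rt_simple i : rt (alpha i) (alphav i).
Proof. by exists (W1), i; rewrite actX1 actY1; split=> //; exact: Wv1. Qed.

Lemma rt_act w g gv : in_Wv w -> rt g gv -> rt (actX w g) (actY w gv).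
Proof.
move=> hw [v [i [hv [-> ->]]]]; exists (Wmul w v), i.
by rewrite actXM actYM; split=> //; exact: in_WvM.
Qed.

Lemma rt_pair g gv : rt g gv -> pairing gv g = 2.
Proof. by move=> [v [i [hv [-> ->]]]]; rewrite pair_act // pair_diag. Qed.

Lemma rt_opp g gv : rt g gv -> rt (- g) (- gv).
Proof.
move=> [v [i [hv [-> ->]]]]; exists (Wmul v (sr i)), i.
rewrite actXM actYM actX_sr actY_sr pair_diag -actXN -actYN.
have e (m : nat) (x : 'rV[int]_m) : - x = x - 2 *: x by vring.
by rewrite -!e; split=> //; apply: in_WvM => //; exact: in_Wv_sr.
Qed.

Lemma rt_sign g gv : rt g gv ->
  (cone alpha g /\ cone alphav gv) \/ (cone alpha (- g) /\ cone alphav (- gv)).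
Proof. by move=> [w [i [hw [-> ->]]]]; exact: wpos_or_neg. Qed.

Lemma rt_neq0 g gv : rt g gv -> g <> 0.
Proof. by move=> /rt_pair h g0; move: h; rewrite g0 pairing0r. Qed.

Lemma refl_conj w g gv : in_Wv w ->
  Wmul w (refl g gv) = Wmul (refl (actX w g) (actY w gv)) w.
Proof.
move=> hw; apply: Wt_ext => x.
  by rewrite !actXM !actX_refl pair_act // actXD actXN actXZ.
by rewrite !actYM !actY_refl pair_act // actYD actYN actYZ.
Qed.

Lemma refl_opp g gv : refl (- g) (- gv) = refl g gv :> Wt.
Proof.
apply: Wt_ext => x; first by rewrite !actX_refl pairingNl scaleNr scalerN opprK.
by rewrite !actY_refl pairingNr scaleNr scalerN opprK.
Qed.

Lemma in_Wv_refl g gv : rt g gv -> in_Wv (refl g gv).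
Proof.
move=> [w [i [hw [-> ->]]]].
have -> : refl (actX w (alpha i)) (actY w (alphav i)) =
          Wmul (Wmul w (sr i)) (Winv w) :> Wt.
  by rewrite refl_conj // -WmulA WmulV // Wmul1.
by apply: in_WvM; [apply: in_WvM => //; exact: in_Wv_sr | exact: in_Wv_inv].
Qed.

Lemma reflK_rt g gv : rt g gv -> Wmul (refl g gv) (refl g gv) = W1.
Proof.
move=> h; apply: Wt_ext => z; rewrite ?actXM ?actYM ?actX1 ?actY1.
  by rewrite !actX_refl !pairingE (rt_pair h) reflK.
by rewrite !actY_refl !pairingE (rt_pair h) reflK.
Qed.

Lemma cone_free (e : I -> V) :
  (forall c : I -> int, \sum_i c i *: e i = 0 -> forall i, c i = 0) ->
  forall b c : I -> int, \sum_i b i *: e i = \sum_i c i *: e i ->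
  forall i, b i = c i.
Proof.
move=> free b c h i; apply/eqP; rewrite -subr_eq0; apply/eqP.
apply: (free (fun i => b i - c i)); rewrite -[RHS](subrr (\sum_i c i *: e i)) -{1}h -sumrB.
by apply: eq_bigr => j _; rewrite scalerBl.
Qed.

Definition root_free := cone_free (@kmalpha_free D).
Definition coroot_free := cone_free (@kmalphav_free D).

Lemma cone_split (e : I -> V) (b c : I -> nat) :
  \sum_i ((b i)%:Z + (c i)%:Z) *: e i = \sum_i (b i)%:Z *: e i + \sum_i (c i)%:Z *: e i.
Proof. by rewrite -big_split; apply: eq_bigr => i _; rewrite scalerDl. Qed.

Lemma cone_antisym x : cone alpha x -> cone alpha (- x) -> x = 0.
Proof.
move=> [b eb] [c ec].
have : \sum_i ((b i)%:Z + (c i)%:Z) *: alpha i = 0.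
  by rewrite cone_split -eb -ec subrr.
move=> /kmalpha_free h; rewrite eb big1 // => i _.
by have := h i; case: (b i) => [|n]; rewrite ?scale0r //; lia.
Qed.

Lemma simple_sum i (m : int) : m *: alpha i = \sum_j (if j == i then m else 0) *: alpha j.
Proof.
rewrite (bigD1 i) //= eqxx big1 ?addr0 // => j /negbTE->.
by rewrite scale0r.
Qed.

(** Carrying the root back to a simple root alpha_j writes alpha_j as [c] times an integral
    combination of simple roots, so [c] divides 1. *)
Lemma root_multiple i (c : nat) gv : rt (c%:Z *: alpha i) gv -> c = 1%N.
Proof.
move=> [w [j [hw [e _]]]].
have {}e : alpha j = c%:Z *: actX (Winv w) (alpha i) by rewrite -actXZ e actXK.
have [f ef] : exists f : I -> int, actX (Winv w) (alpha i) = \sum_k f k *: alpha k.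
  have [[]|[]] := rt_sign (rt_act (in_Wv_inv hw) (rt_simple i)); move=> [b eb] _.
    by exists (fun k => (b k)%:Z).
  exists (fun k => - (b k)%:Z); rewrite -[LHS]opprK eb -sumrN.
  by apply: eq_bigr => k _; rewrite scaleNr.
rewrite ef scaler_sumr -[LHS]scale1r simple_sum in e.
have {}e : \sum_k (if k == j then 1 else 0) *: alpha k = \sum_k (c%:Z * f k) *: alpha k.
  by rewrite e; apply: eq_bigr => k _; rewrite scalerA.
have := root_free e j; rewrite eqxx.
case: (f j) => [[|[|n]]|n]; nia.
Qed.

(* Only [alpha i] changes sign: any other positive root has a positive
   coefficient at some [j != i], which [sr i] leaves unchanged. *)
Lemma sr_pos i g gv : rt g gv -> cone alpha g -> g <> alpha i ->
  cone alpha (actX (sr i) g).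
Proof.
move=> hg [c ec] gi; have [[]//|[[b eb] _]] := rt_sign (rt_act (in_Wv_sr i) hg).
case: gi; rewrite actX_sr in eb.
set m := pairing _ _ in eb.
have {}eb : \sum_k ((b k)%:Z + (c k)%:Z) *: alpha k = m *: alpha i.
  transitivity (- (g - m *: alpha i) + g); last by vring.
  by rewrite eb ec cone_split.
rewrite simple_sum in eb.
have c0 k : k != i -> c k = 0%N.
  by move=> ki; have := root_free eb k; rewrite (negbTE ki); lia.
have eg : g = (c i)%:Z *: alpha i.
  by rewrite ec (bigD1 i) //= big1 ?addr0 // => k /c0->; rewrite scale0r.
rewrite eg in hg; rewrite eg (root_multiple hg); exact: scale1r.
Qed.

(** One may move [g] to a simple root alpha_i. Roots and coroots share their sign, so the other
    coroot [z] is positive while s_i z is negative. As s_i changes only the coefficient of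
    alpha_i^v, [z] is a multiple of alpha_i^v, and <z, alpha_i> = 2 fixes the factor. *)
Lemma coroot_unique g gv gv' : rt g gv -> rt g gv' -> gv = gv'.
Proof.
move=> [w [i [hw [-> ->]]]] h'.
suff : actY (Winv w) gv' = alphav i by move=> <-; rewrite actYVK.
have := rt_act (in_Wv_inv hw) h'; rewrite actXK //; move: (actY _ gv') => z hz.
have pos : cone alphav z.
  have [[]//|[h _]] := rt_sign hz.
  by case: (rt_neq0 hz); apply: cone_antisym h; exact: cone_basis.
have neg : cone alphav (- actY (sr i) z).
  have [[h _]|[]//] := rt_sign (rt_act (in_Wv_sr i) hz).
  case: (rt_neq0 hz); apply: cone_antisym; first exact: cone_basis.
  rewrite (_ : - alpha i = actX (sr i) (alpha i)) // actX_sr pair_diag; vring.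
move: pos neg => [b eb] [c ec]; rewrite actY_sr (rt_pair hz) in ec.
have e : \sum_k ((b k)%:Z + (c k)%:Z) *: alphav k = 2 *: alphav i.
  transitivity (- (z - 2 *: alphav i) + z); last by vring.
  by rewrite ec eb addrC cone_split.
have simp (m : int) : m *: alphav i = \sum_j (if j == i then m else 0) *: alphav j.
  by rewrite (bigD1 i) //= eqxx big1 ?addr0 // => j /negbTE->; rewrite scale0r.
rewrite simp in e.
have b0 k : k != i -> b k = 0%N.
  by move=> ki; have := coroot_free e k; rewrite (negbTE ki); lia.
have ez : z = (b i)%:Z *: alphav i.
  by rewrite eb (bigD1 i) //= big1 ?addr0 // => k /b0->; rewrite scale0r.
have := rt_pair hz; rewrite ez pairingZl pair_diag => b1.
have -> : (b i)%:Z = 1 by lia.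
exact: scale1r.
Qed.

Lemma pos_rootP g : pos_root g <-> (exists gv, rt g gv) /\ cone alpha g.
Proof.
split=> -[h c]; split=> //; first exact: is_root_rt.
by case: h => gv; exact: rt_root.
Qed.

Lemma pos_simple i : pos_root (alpha i).
Proof.
by apply/pos_rootP; split; [exists (alphav i); exact: rt_simple | exact: cone_basis].
Qed.

Lemma pos_not_neg g : pos_root g -> ~ cone alpha (- g).
Proof. by move=> /pos_rootP[[gv /rt_neq0 g0] c] /(cone_antisym c). Qed.

Lemma root_sign g gv : rt g gv -> pos_root g \/ pos_root (- g).
Proof.
move=> h; have [[c _]|[c _]] := rt_sign h; [left|right]; apply/pos_rootP.
  by split=> //; exists gv.
by split=> //; exists (- gv); exact: rt_opp.
Qed.

Lemma sr_pos_root i g : pos_root g -> g <> alpha i -> pos_root (actX (sr i) g).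
Proof.
move=> /pos_rootP[[gv h] c] gi; apply/pos_rootP; split; last exact: sr_pos h c gi.
by exists (actY (sr i) gv); apply: rt_act => //; exact: in_Wv_sr.
Qed.

Lemma actX_srK i x : actX (sr i) (actX (sr i) x) = x.
Proof. by rewrite -actXM srK actX1. Qed.

Lemma actY_srK i x : actY (sr i) (actY (sr i) x) = x.
Proof. by rewrite -actYM srK actY1. Qed.

Lemma actX_sr_simple i : actX (sr i) (alpha i) = - alpha i.
Proof. by rewrite actX_sr pair_diag; vring. Qed.

Lemma pair_srr i y x : pairing y (actX (sr i) x) = pairing (actY (sr i) y) x.
Proof. by rewrite -[in LHS](actY_srK i y) pair_act //; exact: in_Wv_sr. Qed.

Lemma sr_pos_neq i g : pos_root g -> actX (sr i) g <> alpha i.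
Proof.
move=> h e; apply: (pos_not_neg h).
rewrite -(actX_srK i g) e actX_sr_simple opprK; exact: cone_basis.
Qed.

(** * Inversion sets and the integral Tits cone *)

Lemma finite_inversions u : in_Wv u ->
  finite_pred (fun g => pos_root g /\ cone alpha (- actX u g)).
Proof.
move=> /in_WvP[s ->]; elim/last_ind: s => [|s i IH].
  by apply: finite0 => g [/pos_not_neg h]; rewrite actX1 => /h.
(* The inversions of w s_i are images under s_i of inversions of w, together with possibly
   alpha_i. *)
have IH' : finite_pred (fun g => exists2 h, pos_root h /\ cone alpha (- actX (wordW s) h)
      & g = actX (sr i) h) by apply: finite_image IH => y h; exact: h.
apply: finite_sub (finiteU (finite1 (alpha i)) IH') => g [hg].
rewrite wordW_rcons actXM => hn.
have [->|gi] := classic (g = alpha i); [by left | right].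
by exists (actX (sr i) g); rewrite ?actX_srK //; split=> //; exact: sr_pos_root.
Qed.

Lemma Ypp_cone mu x : Ypp mu -> cone alpha x -> 0 <= pairing mu x.
Proof.
move=> h [c ->]; rewrite pairing_sumr; apply: sumr_ge0 => i _.
by rewrite pairingZr mulr_ge0 //; exact: h.
Qed.

Lemma Yplus_act w l : in_Wv w -> Yplus l -> Yplus (actY w l).
Proof.
move=> hw [v [mu [hv [hm ->]]]]; exists (Wmul w v), mu.
by rewrite actYM; split=> //; exact: in_WvM.
Qed.

Lemma Ypp_Yplus mu : Ypp mu -> Yplus mu.
Proof. by move=> h; exists (W1), mu; rewrite actY1; split=> //; exact: Wv1. Qed.

(** For l = w mu with [mu] dominant, a positive root negative on [l] is an inversion of the inverse
    of w. With its converse [finite_Yplus] this characterizes the Tits cone without reference to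
    w. *)
Lemma Yplus_finite l : Yplus l -> finite_pred (fun g => pos_root g /\ pairing l g < 0).
Proof.
move=> [w [mu [hw [hm ->]]]].
apply: finite_sub (finite_inversions (in_Wv_inv hw)) => g [hg neg]; split=> //.
have /pos_rootP[[gv h] _] := hg.
have [[c _]|[]//] := rt_sign (rt_act (in_Wv_inv hw) h).
by move: neg; rewrite -(actXVK g hw) pair_act // ltNge Ypp_cone.
Qed.

(** If [l] is not dominant, some alpha_i is negative on it. Passing to s_i l removes alpha_i from
    the list and carries the other listed roots along by s_i, so the list gets shorter until a
    dominant element is reached. *)
Lemma finite_Yplus l : finite_pred (fun g => pos_root g /\ pairing l g < 0) -> Yplus l.
Proof.
move=> [L]; have [n] := ubnP (size L); elim: n L l => // n IH L l sL hL.
have [|/not_all_ex_not[i /negP]] := classic (Ypp l); first exact: Ypp_Yplus.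
rewrite -ltNge => li; rewrite -(actY_srK i l).
apply: Yplus_act; first exact: in_Wv_sr.
have iL : alpha i \in L by apply: hL; split=> //; exact: pos_simple.
apply: (IH [seq actX (sr i) g | g <- rem (alpha i) (undup L)]).
  rewrite size_map size_rem ?mem_undup //.
  have L0 : (0 < size L)%N by case: (L) iL.
  by have := size_undup L; lia.
move=> g [hg]; rewrite -pair_srr => neg.
have gi : g <> alpha i.
  by move=> e; move: neg; rewrite e actX_sr_simple pairingNr; lia.
rewrite -(actX_srK i g) map_f // mem_rem_uniq ?undup_uniq // inE mem_undup.
apply/andP; split; first by apply/eqP; exact: sr_pos_neq.
by apply: hL; split=> //; exact: sr_pos_root.
Qed.

(* [nu - q *: gv] lies on the segment from [nu] to its reflection, and a root
   negative on it is negative on one of the endpoints. *)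
Lemma Yplus_segment nu g gv (q : int) : rt g gv -> Yplus nu ->
  0 <= q -> q <= pairing nu g -> Yplus (nu - q *: gv).
Proof.
move=> h hn q0 qp; apply: finite_Yplus.
have hn' : Yplus (actY (refl g gv) nu) by apply: Yplus_act => //; exact: in_Wv_refl.
apply: finite_sub (finiteU (Yplus_finite hn) (Yplus_finite hn')) => b [hb].
rewrite actY_refl !pairingE => neg.
have [|nb] := ltP (pairing nu b) 0; [by left | right; split=> //].
rewrite ltNge; apply/negP => nb'.
have c0 : 0 < pairing gv b by rewrite ltNge; apply/negP => c0; nia.
have pq : 0 <= (pairing nu g - q) * pairing gv b by apply: mulr_ge0; lia.
by nia.
Qed.

End Roots.

(** * Reflection steps written from their lower element *)

Section AffineOrder.
Variable D : KMRootDatum.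
Local Notation I := (kmI D).
Local Notation d := (kmd D).
Local Notation V := 'rV[int]_d.
Local Notation alpha := (@kmalpha D).
Local Notation alphav := (@kmalphav D).
Local Notation Wt := (Wt D).
Local Notation in_Wv := (@in_Wv D).
Local Notation rt := (@root_coroot D).
Local Notation Et := (Et D).
(** Coordinates are stored as a finite function so that these data form an [eqType], as [dickson]
    requires. *)
Local Notation cdata := (V * V * {ffun I + I -> nat})%type.
Implicit Types (u v w : Wt) (b bv g gv l mu nu : V) (i j : I) (x y z : Et).

(* The element [u varpi^mu]. *)
Definition wt_tr u mu : Et := (actY u mu, u).

Lemma wt_tr_inj u v mu nu : in_Wv u -> wt_tr u mu = wt_tr v nu -> u = v /\ mu = nu.
Proof.
move=> hu [e uv]; split=> //; rewrite -uv in e.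
by rewrite -[mu](actYK _ hu) e actYK.
Qed.

Lemma wt_trP x : in_Wplus x ->
  exists u mu, [/\ in_Wv u, Yplus mu & x = wt_tr u mu].
Proof.
case: x => l u [/= hl hu]; exists u, (actY (Winv u) l).
by rewrite /wt_tr actYVK //; split=> //; apply: Yplus_act => //; exact: in_Wv_inv.
Qed.

(** The condition for x = u varpi^mu to lie one step below y = u s_g varpi^(mu + q g^v). The
    reflecting affine root is (-u g, q), and the first clause makes it positive. Its pullback along
    y is (g, -q - <mu, g>), and the second clause makes that negative. *)
Definition ascent u mu g (q : int) :=
  (0 < q \/ q = 0 /\ pos_root (- actX u g)) /\
  (0 < q + pairing mu g \/ q + pairing mu g = 0 /\ pos_root (- g)).

Lemma refl_rtX g gv : rt g gv -> actX (refl g gv : Wt) g = - g.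
Proof. by move=> h; rewrite actX_refl (rt_pair h); vring. Qed.

Lemma refl_rtY g gv : rt g gv -> actY (refl g gv : Wt) gv = - gv.
Proof. by move=> h; rewrite actY_refl (rt_pair h); vring. Qed.

Lemma aroot_pullback v nu g (q : int) : in_Wv v ->
  Eact (Einv (wt_tr v nu)) (actX v g, q) = (g, q - pairing nu g).
Proof. by move=> hv; rewrite /Eact /Einv /= actYK // actXK // pairingNl. Qed.

Lemma s_aff_wt_tr v nu g gv (q : int) : in_Wv v -> rt g gv ->
  Emul (s_aff (actX v g, q) (actY v gv)) (wt_tr v nu) =
  wt_tr (Wmul v (refl g gv)) (nu - q *: gv).
Proof.
move=> hv h; rewrite /Emul /s_aff /wt_tr /=; congr pair; last by rewrite -refl_conj.
rewrite -actYM -refl_conj // !actYM -actYZ -actYD; congr actY.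
by rewrite actYD actYN actYZ (refl_rtY h); vring.
Qed.

Lemma ascent_bstep u mu g gv q : in_Wv u -> rt g gv -> ascent u mu g q ->
  Yplus (mu + q *: gv) ->
  bstep (wt_tr u mu) (wt_tr (Wmul u (refl g gv)) (mu + q *: gv)).
Proof.
move=> hu h [h1 h2] hY; set v := Wmul u _.
have hv : in_Wv v by apply: in_WvM => //; exact: in_Wv_refl.
have vg : actX v g = - actX u g by rewrite actXM (refl_rtX h) actXN.
split; first by split=> //=; exact: Yplus_act.
exists (actX v g, q), (actY v gv); split; last split; last split.
- split=> /=; first by apply: (@rt_root D _ (actY v gv)); exact: rt_act.
  by case: h1 => [q0|[-> p]]; [left | right; rewrite vg].
- exact: rt_act.
- rewrite aroot_pullback // /pos_aroot /= !pairingE (rt_pair h) => -[_].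
  case=> [|[e p]]; first by case: h2 => [|[]]; lia.
  case: h2 => [|[_ p']]; first by lia.
  by case/pos_rootP: p => _ c; case: (pos_not_neg p'); rewrite opprK.
- rewrite s_aff_wt_tr // -WmulA (reflK_rt h) Wmul1; congr wt_tr; vring.
Qed.

Lemma bstep_ascent u mu y : in_Wv u -> bstep (wt_tr u mu) y ->
  exists g gv q, [/\ rt g gv, ascent u mu g q, Yplus (mu + q *: gv)
    & y = wt_tr (Wmul u (refl g gv)) (mu + q *: gv)].
Proof.
move=> hu [/wt_trP[v [nu [hv hnu ->]]] [[b q] [bv [pa [/= rb [npa e]]]]]].
have [g [gv [h eb ebv]]] : exists g gv, [/\ rt g gv, b = actX v g & bv = actY v gv].
  exists (actX (Winv v) b), (actY (Winv v) bv); rewrite actXVK // actYVK //.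
  by split=> //; apply: rt_act => //; exact: in_Wv_inv.
move: pa npa e; rewrite {}eb {}ebv {rb b bv} aroot_pullback // s_aff_wt_tr //.
move=> [_ pa] npa /(wt_tr_inj hu)[eu emu].
have wordW : v = Wmul u (refl g gv) by rewrite eu -WmulA (reflK_rt h) Wmul1.
have enu : nu = mu + q *: gv by rewrite emu; vring.
exists g, gv, q; rewrite -enu -wordW; split=> //; split.
  case: pa => /= [|[-> p]]; [by left | right; split=> //].
  by move: p; rewrite wordW actXM (refl_rtX h) actXN.
move: npa; rewrite /pos_aroot /= enu !pairingE (rt_pair h) => npa.
have [|le] := ltP 0 (q + pairing mu g); [by left | right].
have [e|ne] := eqVneq (q + pairing mu g) 0; last first.
  by case: npa; split; [exact: rt_root h | left; lia].
split=> //; have [p|//] := root_sign h.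
by case: npa; split; [exact: rt_root h | right; split=> //; lia].
Qed.

(** The ascent gives 0 <= q <= <mu, g> + 2 q, so [mu] lies between mu + q g^v and its reflection
    along [g]. Hence a reflection going down stays in the semigroup. *)
Lemma ascent_Yplus u mu g gv q : rt g gv -> ascent u mu g q ->
  Yplus (mu + q *: gv) -> Yplus mu.
Proof.
move=> h [h1 h2] hY; have -> : mu = (mu + q *: gv) - q *: gv by vring.
apply: (Yplus_segment h hY); first by case: h1 => [|[]]; lia.
by rewrite !pairingE (rt_pair h); case: h2 => [|[]]; lia.
Qed.

(** * Right multiplication by a simple reflection and the lifting property *)

Definition mul_sr i x : Et := (x.1, Wmul x.2 (sr i)).

Lemma mul_srK i x : mul_sr i (mul_sr i x) = x.
Proof. by case: x => l u; rewrite /mul_sr /= -WmulA srK Wmul1. Qed.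

Lemma mul_sr_wt_tr i u mu : mul_sr i (wt_tr u mu) = wt_tr (Wmul u (sr i)) (actY (sr i) mu).
Proof. by rewrite /mul_sr /wt_tr /= actYM actY_srK. Qed.

(* [pos_simple_im u mu i]: the affine root [u varpi^mu (alpha i, 0)] is positive. *)
Definition pos_simple_im u mu i :=
  0 < pairing mu (alpha i) \/ pairing mu (alpha i) = 0 /\ pos_root (actX u (alpha i)).

Lemma rt_simple_opp i : rt (- alpha i) (- alphav i).
Proof. by apply: rt_opp; exact: rt_simple. Qed.

(** Right multiplication by s_i is the ascent along -alpha_i with q = <mu, alpha_i>. The second
    clause of [ascent] then holds in its boundary case. *)
Lemma bstep_mul_sr u mu i : in_Wv u -> Yplus mu -> pos_simple_im u mu i ->
  bstep (wt_tr u mu) (mul_sr i (wt_tr u mu)).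
Proof.
move=> hu hmu h; rewrite mul_sr_wt_tr.
have e : actY (sr i) mu = mu + pairing mu (alpha i) *: - alphav i.
  by rewrite actY_sr; vring.
have -> : sr i = refl (- alpha i) (- alphav i) by rewrite refl_opp.
rewrite -[actY _ mu]/(actY (refl _ _) mu) refl_opp e -(refl_opp (alpha i)).
apply: ascent_bstep => //; first exact: rt_simple_opp.
  split; last by right; rewrite pairingNr subrr opprK; split=> //; exact: pos_simple.
  by case: h => [|[-> p]]; [left | right; rewrite actXN opprK].
by rewrite -e; apply: Yplus_act => //; exact: in_Wv_sr.
Qed.

Lemma bstep_mul_sr_neg u mu i : in_Wv u -> Yplus mu -> ~ pos_simple_im u mu i ->
  bstep (mul_sr i (wt_tr u mu)) (wt_tr u mu).
Proof.
move=> hu hmu h; rewrite -[X in bstep _ X](mul_srK i) mul_sr_wt_tr.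
apply: bstep_mul_sr; [by apply: in_WvM => //; exact: in_Wv_sr
  | by apply: Yplus_act => //; exact: in_Wv_sr|].
rewrite /pos_simple_im -pair_srr actX_sr_simple pairingNr actXM actX_sr_simple actXN.
have [|le] := ltP 0 (- pairing mu (alpha i)); [by left | right].
have [e|ne] := eqVneq (pairing mu (alpha i)) 0; last by case: h; left; lia.
rewrite e; split=> //; have [p|//] := root_sign (rt_act hu (rt_simple i)).
by case: h; right.
Qed.

Lemma bstep_mul_sr_total x i : in_Wplus x -> bstep x (mul_sr i x) \/ bstep (mul_sr i x) x.
Proof.
move=> /wt_trP[u [mu [hu hmu ->]]].
have [p|p] := classic (pos_simple_im u mu i); [left|right].
  exact: bstep_mul_sr.
exact: bstep_mul_sr_neg.
Qed.

Lemma bstep_low x y : bstep x y -> in_Wplus x.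
Proof.
move=> h; have [u [mu [hu ex]]] : exists u mu, in_Wv u /\ x = wt_tr u mu.
  case: h => [/wt_trP[v [nu [hv _ ->]]] [[b q] [bv [_ [/= rb [_ ->]]]]]].
  set z := Emul _ _; exists z.2, (actY (Winv z.2) z.1).
  have hz : in_Wv z.2 by apply: in_WvM => //; exact: in_Wv_refl.
  by rewrite /wt_tr actYVK //; split=> //; case: (z).
rewrite ex in h *; have [g [gv [q [rg up hY _]]]] := bstep_ascent hu h.
by split=> //=; apply: Yplus_act => //; exact: ascent_Yplus rg up hY.
Qed.

(** Replacing [g] by s_i g leaves the first clause of [ascent] unchanged, and the second survives
    because s_i permutes the positive roots other than alpha_i. The only failure, g = -alpha_i with
    q + <mu, g> = 0, is the step from x to x s_i. *)
Lemma bstep_mul_sr_compat x y i : bstep x y ->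
  y = mul_sr i x \/ bstep (mul_sr i x) (mul_sr i y).
Proof.
move=> h; have /wt_trP[u [mu [hu hmu ex]]] := bstep_low h.
rewrite {}ex in h *; have [g [gv [q [rg [h1 h2] hY ->]]]] := bstep_ascent hu h.
have hi := in_Wv_sr i.
have e2 : Wmul (Wmul u (refl g gv)) (sr i) =
          Wmul (Wmul u (sr i)) (refl (actX (sr i) g) (actY (sr i) gv)).
  by rewrite -!WmulA (refl_conj _ _ hi) actX_srK actY_srK.
have [[qg0 gi]|no] := classic (q + pairing mu g = 0 /\ g = - alpha i).
  left; have egv : gv = - alphav i.
    by rewrite gi in rg; apply: coroot_unique rg (rt_simple_opp i).
  rewrite mul_sr_wt_tr gi egv refl_opp; congr wt_tr; rewrite actY_sr.
  have -> : q = pairing mu (alpha i) by move: qg0; rewrite gi pairingNr; lia.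
  by vring.
right; rewrite !mul_sr_wt_tr e2 actYD actYZ.
apply: ascent_bstep; [exact: in_WvM | exact: rt_act | | ].
  split; first by rewrite actXM actX_srK.
  rewrite (pair_act _ _ hi); case: h2 => [|[qg0 p]]; [by left | right; split=> //].
  rewrite -actXN; apply: sr_pos_root => // e; case: no; split=> //.
  by rewrite -e opprK.
by rewrite -actYZ -actYD; exact: Yplus_act.
Qed.

Lemma bruhat_le_trans x y z : bruhat_le x y -> bruhat_le y z -> bruhat_le x z.
Proof. exact: rt_trans. Qed.

Lemma bruhat_le_step x y : bstep x y -> bruhat_le x y.
Proof. exact: rt_step. Qed.

Lemma le_Wplus x y : bruhat_le x y -> in_Wplus x -> in_Wplus y.
Proof. by elim=> // [a b [] | a b c _ h1 _ h2 /h1/h2]. Qed.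

(** The steps of a chain from [x] to [y] are multiplied by s_i one after another. If a step is
    itself multiplication by s_i, the rest of the original chain finishes; otherwise y s_i < y
    does. *)
Lemma lift_down x y i : bruhat_le x y -> bstep (mul_sr i y) y -> bruhat_le (mul_sr i x) y.
Proof.
move=> /(clos_rt_rt1n _ _ _ _); elim=> [z /bruhat_le_step //|a b c ab bc IH hc].
have [e|h] := bstep_mul_sr_compat i ab; last by apply: bruhat_le_trans (bruhat_le_step h) (IH hc).
by rewrite -e; apply: clos_rt1n_rt.
Qed.

Lemma bstep_neq x y : bstep x y -> x <> y.
Proof.
move=> h; have /wt_trP[u [mu [hu hmu ex]]] := bstep_low h.
rewrite {}ex in h *; have [g [gv [q [rg _ _ ->]]]] := bstep_ascent hu h.
move=> /(wt_tr_inj hu)[e _]; apply: (rt_neq0 rg).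
have : actX u g = actX u (- g) by rewrite -[in RHS](refl_rtX rg) -actXM -e.
move=> /(congr1 (actX (Winv u))); rewrite !actXK // => /eqP; rewrite -addr_eq0 => /eqP gg.
apply/rowP => k; have := congr1 (fun r : V => r 0 k) gg; rewrite /= !mxE -mulr2n => /eqP.
by rewrite mulrn_eq0 => /eqP.
Qed.

(** * Covers and right descents *)

Lemma cover_between x y z : covers y x -> bruhat_le x z -> bruhat_le z y ->
  z = x \/ z = y.
Proof.
move=> [_ no] xz zy; have [->|zx] := classic (z = x); first by left.
by right; apply: NNPP => zy'; apply: no; exists z; split; split=> // /esym.
Qed.

Lemma cover_next x y z : covers y x -> bstep x z -> bruhat_le z y -> z = y.
Proof.
move=> c xz zy; have [zx|//] := cover_between c (bruhat_le_step xz) zy.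
by have := bstep_neq xz; rewrite zx.
Qed.

Lemma cover_bstep x y : covers y x -> bstep x y.
Proof.
move=> c; have [[le ne] _] := c; case: {le}(clos_rt_rt1n _ _ _ _ le) ne c => // b z xb bz _ c.
by rewrite -(cover_next c xb (clos_rt1n_rt _ _ _ _ bz)).
Qed.

(** If x < x s_i, lifting gives x s_i <= y, hence equality. Otherwise a [z] strictly between x s_i
    and y s_i would put either z s_i or [z] between [x] and [y], according to whether multiplication
    by s_i raises or lowers [z]. *)
Lemma cover_descent x y i : covers y x -> bstep (mul_sr i y) y ->
  y = mul_sr i x \/ bstep (mul_sr i x) x /\ covers (mul_sr i y) (mul_sr i x).
Proof.
move=> c yi; have xy := cover_bstep c.
have [xi|xi] := bstep_mul_sr_total i (bstep_low xy).
  by left; rewrite (cover_next c xi (lift_down (bruhat_le_step xy) yi)).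
have [->|h] := bstep_mul_sr_compat i xy; first by left.
have [|yx] := classic (y = mul_sr i x); [by left | right; split=> //].
split; first by split; [exact: bruhat_le_step | exact: bstep_neq].
move=> [z [[xz nxz] [zy nzy]]].
have hz : in_Wplus z by apply: le_Wplus xz _; exact: bstep_low xi.
have zy' : bruhat_le z y by apply: bruhat_le_trans zy (bruhat_le_step yi).
have [zi|zi] := bstep_mul_sr_total i hz.
  have h1 : bruhat_le (mul_sr i z) y by exact: lift_down.
  have h2 : bruhat_le x (mul_sr i z).
    rewrite -(mul_srK i x); apply: lift_down; last by rewrite mul_srK.
    by apply: bruhat_le_trans xz (bruhat_le_step zi).
  have [e|e] := cover_between c h2 h1.
    by case: nxz; rewrite -e mul_srK.
  by case: nzy; rewrite -e mul_srK.
have h2 : bruhat_le x z by rewrite -(mul_srK i x); exact: lift_down.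
have [e|e] := cover_between c (bruhat_le_trans h2 zy) (bruhat_le_step yi).
  by apply: yx; rewrite -e mul_srK.
by have := bstep_neq yi; rewrite e.
Qed.

(* Three reflections along [g], [t], [g] factor the reflection along
   [b = s_g t]; every intermediate element stays in W+. *)
Lemma cover_chain u mu g gv t tv b bv (q1 q2 q3 m : int) :
  in_Wv u -> rt g gv -> rt t tv ->
  b = actX (refl g gv) t -> bv = actY (refl g gv) tv ->
  Yplus (mu + m *: bv) ->
  m *: bv = q1 *: gv + q2 *: tv + q3 *: gv ->
  covers (wt_tr (Wmul u (refl b bv)) (mu + m *: bv)) (wt_tr u mu) ->
  ascent u mu g q1 ->
  ascent (Wmul u (refl g gv)) (mu + q1 *: gv) t q2 ->
  ascent (Wmul (Wmul u (refl g gv)) (refl t tv)) (mu + q1 *: gv + q2 *: tv) g q3 ->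
  wt_tr (Wmul u (refl g gv)) (mu + q1 *: gv) =
  wt_tr (Wmul u (refl b bv)) (mu + m *: bv).
Proof.
move=> hu rg rt' eb ebv hY em c a1 a2 a3.
have hg := in_Wv_refl rg; have ht := in_Wv_refl rt'.
have es : Wmul u (refl b bv) = Wmul (Wmul (Wmul u (refl g gv)) (refl t tv)) (refl g gv).
  rewrite -!WmulA; congr Wmul; rewrite WmulA.
  by rewrite (refl_conj _ _ hg) -WmulA (reflK_rt rg) Wmul1 -eb -ebv.
have hv := in_WvM hu hg; have hw := in_WvM hv ht.
have em' : mu + m *: bv = mu + q1 *: gv + q2 *: tv + q3 *: gv.
  by rewrite em !addrA.
have Y3 : Yplus (mu + q1 *: gv + q2 *: tv + q3 *: gv) by rewrite -em'.
have Y2 := ascent_Yplus rg a3 Y3; have Y1 := ascent_Yplus rt' a2 Y2.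
apply: (cover_next c); first exact: ascent_bstep.
apply: bruhat_le_trans (bruhat_le_step (ascent_bstep hv rt' a2 Y2)) _.
by rewrite es em'; apply: bruhat_le_step; exact: ascent_bstep.
Qed.

(** * Covers of a fixed element that have no right descent *)

Section FixedBottom.
Variables (u : Wt) (mu : V).
Hypotheses (hu : in_Wv u) (hmu : Yplus mu).

Definition up_by b bv (m : int) : Et := wt_tr (Wmul u (refl b bv)) (mu + m *: bv).

(* The dihedral group of [b] alone rules out large translations. *)
Lemma cover_mult_bound b bv (m k : int) : rt b bv -> pos_root b ->
  Yplus (mu + m *: bv) -> covers (up_by b bv m) (wt_tr u mu) ->
  0 < k -> 0 < k + pairing mu b -> m <= k.
Proof.
move=> h pb hY c k0 kb; rewrite leNgt; apply/negP => km.
have h2 := rt_pair h.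
have e : wt_tr (Wmul u (refl b bv)) (mu + k *: bv) = up_by b bv m.
  (* The middle exponent puts the second ascent in its boundary case, settled by the positivity of
     [b]. The third restores the total [m], and its ascent condition comes down to k < m. *)
  apply: (@cover_chain u mu b bv (- b) (- bv) b bv k (pairing mu b + 2 * k)
    (m + pairing mu b + k) m) => //.
  - exact: rt_opp.
  - by rewrite actXN (refl_rtX h) opprK.
  - by rewrite actYN (refl_rtY h) opprK.
  - by vring.
  - by split; left.
  - split; first by left; lia.
    by right; rewrite !pairingE h2 opprK; split=> //; lia.
  - by split; left; rewrite ?pairingE ?h2; lia.
have [_ /addrI e'] := wt_tr_inj (in_WvM hu (in_Wv_refl h)) e.
by have := congr1 (fun r : V => pairing r b) e'; rewrite !pairingZl h2; lia.
Qed.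

(** The chain reflects along [g], s_g b, [g] with exponents 1, 1 and <b^v, g> - 1. All are positive,
    so only the second clauses of [ascent] need work; the one for s_g b is the last hypothesis. *)
Lemma cover_chain_root b bv g gv : rt b bv -> rt g gv ->
  Yplus (mu + 1 *: bv) -> covers (up_by b bv 1) (wt_tr u mu) ->
  2 <= pairing bv g -> 0 <= pairing mu g ->
  pairing gv b * (pairing mu g + 1) < 1 + pairing mu b ->
  up_by g gv 1 = up_by b bv 1.
Proof.
move=> hb hg hY c n2 mg hlt; have h2 := rt_pair hg.
have rg := in_Wv_refl hg.
apply: (@cover_chain u mu g gv (actX (refl g gv) b) (actY (refl g gv) bv) b bv 1 1
    (pairing bv g - 1) 1) => //.
- exact: rt_act.
- by rewrite -actXM (reflK_rt hg) actX1.
- by rewrite -actYM (reflK_rt hg) actY1.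
- by rewrite actY_refl; vring.
- by split; left; lia.
- split; left; rewrite // actX_refl !pairingE h2.
  by nia.
- by split; left; rewrite ?actY_refl ?pairingE ?h2; lia.
Qed.

(* Data of a candidate cover [up_by b bv 1]: the coordinates of [b] and of
   the dominant coweight [mu + bv]. *)
Definition candidate (t : cdata) : Prop :=
  let: (b, bv, f) := t in
  [/\ rt b bv, b = \sum_i (f (inl i))%:Z *: alpha i,
      forall i, pairing (mu + bv) (alpha i) = (f (inr i))%:Z,
      0 <= pairing mu b & covers (up_by b bv 1) (wt_tr u mu)].

(** Comparing the [inr] coordinates makes b^v - g^v dominant; it is then paired with the positive
    roots [g] and [b]. *)
Lemma candidate_compare g gv f b bv f' : candidate (g, gv, f) -> candidate (b, bv, f') ->
  (forall k, (f k <= f' k)%N) -> 2 <= pairing bv g /\ pairing gv b <= 2.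
Proof.
move=> [hg eg fg _ _] [hb eb fb _ _] le.
have kap (x : V) : cone alpha x -> 0 <= pairing (bv - gv) x.
  apply: Ypp_cone => i; have := fb i; have := fg i; have := le (inr i).
  by rewrite !pairingE; lia.
have cg : cone alpha g by exists (fun i => f (inl i)).
have cb : cone alpha b by exists (fun i => f' (inl i)).
have := kap _ cg; have := kap _ cb; rewrite !pairingE (rt_pair hg) (rt_pair hb).
by lia.
Qed.

Lemma candidate_Ypp b bv f : candidate (b, bv, f) -> Ypp (mu + bv).
Proof. by move=> [_ _ h _ _] i; rewrite h. Qed.

(** As <g^v, b> <= 2, the hypothesis of [cover_chain_root] holds once <mu, b> >= 2 (<mu, g> + 1). *)
Lemma candidate_bound g gv f b bv f' : candidate (g, gv, f) -> candidate (b, bv, f') ->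
  (forall k, (f k <= f' k)%N) ->
  up_by b bv 1 = up_by g gv 1 \/ pairing mu b < 2 * pairing mu g + 2.
Proof.
move=> cg cb le; have [n2 n'2] := candidate_compare cg cb le.
have Yb := Ypp_Yplus (candidate_Ypp cb).
case: cg cb => [hg _ _ mg _] [hb _ _ mb c].
have [|ge] := ltP (pairing mu b) (2 * pairing mu g + 2); [by right | left].
apply/esym; apply: cover_chain_root => //; first by rewrite scale1r.
by nia.
Qed.

(* When the heights agree, [dl = b - g] is fixed by both reflections, so all
   [g - 2 n dl] are roots; hence [g <= 2 n dl] for large [n], and the dominant
   coweight [mu + gv], which kills [dl], would kill [g]. *)
Lemma candidate_antichain g gv f b bv f' : candidate (g, gv, f) -> candidate (b, bv, f') ->
  (forall k, (f k <= f' k)%N) -> pairing mu b = pairing mu g -> b = g.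
Proof.
move=> cg cb le eqm; have [n2 n'2] := candidate_compare cg cb le.
have Yb := candidate_Ypp cb; have Yg := candidate_Ypp cg.
case: cg cb => [hg eg fg mg _] [hb eb fb mb _].
pose dc i := (f' (inl i) - f (inl i))%N.
have edl : b - g = \sum_i (dc i)%:Z *: alpha i.
  rewrite eb eg -sumrB; apply: eq_bigr => i _; rewrite -scalerBl.
  by rewrite subzn.
have cdl : cone alpha (b - g) by exists dc.
(* Since <mu, b - g> = 0, these give the inequalities opposite to those of [candidate_compare]. *)
have [d1 d2] := (Ypp_cone Yb cdl, Ypp_cone Yg cdl).
have [hb2 hg2] := (rt_pair hb, rt_pair hg).
have {}n2 : pairing bv g = 2 by move: d1; rewrite !pairingE; lia.
have {}n'2 : pairing gv b = 2 by move: d2; rewrite !pairingE; lia.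
have shift (x : V) : pairing gv x = 2 -> pairing bv x = 2 ->
    actX (refl g gv) (actX (refl b bv) x) = x - 2 *: (b - g).
  by move=> xg xb; rewrite !actX_refl !pairingE xg xb n'2; vring.
have roots n : is_root (g - (2 * n%:Z) *: (b - g)).
  suff [gv' h] : exists gv', rt (g - (2 * n%:Z) *: (b - g)) gv' by exact: rt_root h.
  elim: n => [|n [gv' IH]].
    by exists gv; rewrite mulr0 scale0r subr0.
  exists (actY (refl g gv) (actY (refl b bv) gv')).
  have -> : g - (2 * n.+1%:Z) *: (b - g) =
      actX (refl g gv) (actX (refl b bv) (g - (2 * n%:Z) *: (b - g))).
    rewrite shift ?pairingE ?n2 ?n'2 ?hb2 ?hg2; last by ring.
      by apply/rowP => k; rewrite !mxE; lia.
    by ring.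
  by apply: rt_act; [exact: in_Wv_refl | apply: rt_act => //; exact: in_Wv_refl].
apply: NNPP => ne.
have [i di] : exists i, (0 < dc i)%N.
  apply: NNPP => no; apply: ne; apply/eqP; rewrite -subr_eq0 edl big1 // => i _.
  by case: (posnP (dc i)) => [->|h]; [rewrite scale0r | case: no; exists i].
(* This choice makes the coefficient of alpha_i in g - 2n(b - g) negative, so that root is
   negative. *)
pose n := (f (inl i)).+1.
have [gv' h] := is_root_rt (roots n).
have e : g - (2 * n%:Z) *: (b - g) =
    \sum_k ((f (inl k))%:Z - 2 * n%:Z * (dc k)%:Z) *: alpha k.
  rewrite edl eg scaler_sumr -sumrB; apply: eq_bigr => k _.
  by rewrite scalerBl scalerA.
have neg : cone alpha (- (g - (2 * n%:Z) *: (b - g))).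
  have [[[c ec] _]|[]//] := rt_sign h.
  rewrite e in ec; have := root_free ec i; rewrite /n; nia.
(* The pairing of mu + g^v with the negated root is -<mu, g> - 2, yet it should be nonnegative. *)
have := Ypp_cone Yg neg; rewrite !pairingE; move: mg d2; rewrite !pairingE hg2 n'2; lia.
Qed.

(** Dickson's lemma is used twice. A finite base of all candidates bounds <mu, b> outside the base
    elements themselves. For each fixed value of <mu, b> the candidates form an antichain, so a base
    of them already contains all their roots. *)
Lemma finite_candidates : finite_pred (fun y => exists b bv, [/\ rt b bv, pos_root b,
  Ypp (mu + bv), 0 <= pairing mu b & y = up_by b bv 1 /\ covers y (wt_tr u mu)]).
Proof.
pose f (t : cdata) k := t.2 k.
pose Y (t : cdata) := up_by t.1.1 t.1.2 1.
have [B [BP Bt]] := dickson f (enum {: I + I}) candidate.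
have finB (s : seq cdata) :
    finite_pred (fun y => exists2 t, t \in s & y = Y t).
  by exists (map Y s) => y [t ts ->]; exact: map_f.
have finv (v : nat) : finite_pred (
    fun y => exists t : cdata, [/\ candidate t, pairing mu t.1.1 = v%:Z & y = Y t]).
  have [C [CP Ct]] := dickson f (enum {: I + I})
    (fun t => candidate t /\ pairing mu t.1.1 = v%:Z).
  apply: finite_sub (finB C) => y [t [ct tv ->]].
  have [t' tC le] := Ct t (conj ct tv); exists t' => //.
  have [ct' tv'] := CP t' tC.
  move: t t' ct ct' tv tv' le {tC} => [[b bv] h] [[b' bv'] h'] /= ct ct' tv tv' le.
  have e : b = b'.
    apply: (candidate_antichain ct' ct) => [k|]; last by rewrite tv.
    by apply: le; rewrite mem_enum.
  case: ct ct' => [hb _ _ _ _] [hb' _ _ _ _]; rewrite /Y /= -e.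
  by rewrite (coroot_unique hb (_ : rt b bv')) // e.
have finM : finite_pred (fun y => exists2 t, t \in B &
    exists2 v : nat, v \in iota 0 (absz (2 * pairing mu t.1.1 + 2)) &
    exists t' : cdata, [/\ candidate t', pairing mu t'.1.1 = v%:Z & y = Y t']).
  by apply: finite_bigU => t _; apply: finite_bigU => v _; exact: finv.
apply: finite_sub (finiteU (finB B) finM).
move=> y [b [bv [hb pb dom mb [ey c]]]].
have /pos_rootP[_ [cf ecf]] := pb.
pose hf (k : I + I) : nat :=
  match k with inl i => cf i | inr i => `|pairing (mu + bv) (alpha i)|%N end.
pose h : {ffun I + I -> nat} := [ffun k => hf k].
have ct : candidate (b, bv, h).
  split=> //; last by rewrite -ey.
    by rewrite ecf; apply: eq_bigr => i _; rewrite ffunE.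
  by move=> i; rewrite ffunE gez0_abs //; exact: dom.
have [[[b' bv'] h'] tB le] := Bt _ ct.
have le' k : (h' k <= h k)%N by apply: le; rewrite mem_enum.
have [e|lt] := candidate_bound (BP _ tB) ct le'.
  by left; exists (b', bv', h') => //; rewrite ey e.
right; exists (b', bv', h') => //; exists `|pairing mu b|%N.
  by rewrite mem_iota /=; lia.
by exists (b, bv, h); split=> //=; lia.
Qed.

(** Finitely many exceptional [b] have <mu, b> < 0 or u b negative, and for each the exponent [m] is
    bounded. For every other [b], [m] is positive and [cover_mult_bound] with k = 1 forces m = 1,
    which is the case of candidates. *)
Lemma finite_cover_pos : finite_pred (fun y => exists b bv (m : int), [/\ rt b bv, pos_root b,
  ascent u mu b m, Ypp (mu + m *: bv) & y = up_by b bv m /\ covers y (wt_tr u mu)]).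
Proof.
pose exc b := pos_root b /\ (pairing mu b < 0 \/ cone alpha (- actX u b)).
have [L hL] : finite_pred exc.
  apply: finite_sub (finiteU (Yplus_finite hmu) (finite_inversions hu)) => b [pb].
  by case=> h; [left | right].
(* The largest exponent allowed is |<mu, b>| + 1, and [iota 0 n] stops at n - 1. *)
pose bound b := (`|pairing mu b| + 2)%N.
have finL : finite_pred (fun y => exists2 b, b \in L & exists2 m, m \in iota 0 (bound b) &
    exists bv, rt b bv /\ y = up_by b bv m%:Z).
  apply: finite_bigU => b _; apply: finite_bigU => m _.
  have [[bv h]|no] := classic (exists bv, rt b bv); last first.
    by apply: finite0 => y [bv [h _]]; case: no; exists bv.
  apply: finite_sub (finite1 (up_by b bv m%:Z)) => y [bv' [h' ->]].
  by rewrite (coroot_unique h' h).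
apply: finite_sub (finiteU finL finite_candidates) => y [b [bv [m [hb pb [a1 a2] dom [ey c]]]]].
have m0 : 0 <= m by case: a1 => [|[->]] //; lia.
have mb : m <= `|pairing mu b| + 1.
  case: a1 => [mpos|[->]]; last by lia.
  apply: (@cover_mult_bound b bv) => //; try lia.
    exact: Ypp_Yplus.
  by rewrite -ey.
have exceptional : exc b -> exists2 b, b \in L & exists2 m, m \in iota 0 (bound b) &
    exists bv, rt b bv /\ y = up_by b bv m%:Z.
  move=> h; exists b; first exact: hL.
  exists `|m|%N; first by rewrite mem_iota /bound; lia.
  by exists bv; split=> //; rewrite gez0_abs.
have [neg|mbpos] := ltP (pairing mu b) 0.
  by left; apply: exceptional; split=> //; left.
case: a1 => [mpos|[_ /pos_rootP[_ h]]]; last first.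
  by left; apply: exceptional; split=> //; right.
have m1 : m <= 1.
  apply: (@cover_mult_bound b bv) => //; try lia.
    exact: Ypp_Yplus.
  by rewrite -ey.
have em : m = 1 by lia.
rewrite em scale1r in dom ey.
by right; exists b, bv.
Qed.

(** Pairing the dominant mu + m b^v with -b forces m = 0 and <mu, b> = 0. Then <mu, alpha_i> = 0 for
    every alpha_i in the support of -b, so u s_b sends these alpha_i to positive roots. Hence u b =
    u s_b (-b) lies in the positive cone, against the first clause of [ascent]. *)
Lemma no_descent_pos b bv (m : int) : rt b bv -> pos_root (- b) -> ascent u mu b m ->
  (forall i, pos_simple_im (Wmul u (refl b bv)) (mu + m *: bv) i) -> False.
Proof.
move=> hb nb [a1 a2] h; have hb2 := rt_pair hb.
have dom : Ypp (mu + m *: bv) by move=> i; case: (h i) => [|[->]] //; exact: ltW.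
have /pos_rootP[_ cb] := nb.
have := Ypp_cone dom cb; rewrite !pairingE hb2 => le.
have m0 : m = 0 by case: a1 => [|[]//]; case: a2 => [|[]]; lia.
have mb : pairing mu b = 0 by case: a2 => [|[]]; lia.
case: a1 => [|[_ pu]]; first by rewrite m0.
apply: (pos_not_neg pu); rewrite opprK.
have -> : actX u b = actX (Wmul u (refl b bv)) (- b).
  by rewrite actXM actXN (refl_rtX hb) opprK.
case: cb => c ec; rewrite ec actX_sum.
have -> : \sum_i actX (Wmul u (refl b bv)) ((c i)%:Z *: alpha i) =
  \sum_i (c i)%:Z *: actX (Wmul u (refl b bv)) (alpha i).
  by apply: eq_bigr => i _; rewrite actXZ.
apply: cone_sum => i ci; case: (h i) => [pi|[_ /pos_rootP[]//]].
have : pairing (mu + m *: bv) (- b) = 0 by rewrite m0 scale0r addr0 pairingNr mb oppr0.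
rewrite ec pairing_sumr (bigD1 i) //= pairingZr => e0.
have : 0 <= \sum_(j | j != i) pairing (mu + m *: bv) ((c j)%:Z *: alpha j).
  by apply: sumr_ge0 => j _; rewrite pairingZr mulr_ge0 //; exact: dom.
move=> ge; have : 0 < (c i)%:Z * pairing (mu + m *: bv) (alpha i) by rewrite mulr_gt0.
by move=> gt; have := ltr_pwDl gt ge; rewrite e0 ltxx.
Qed.

Lemma finite_cover_no_descent :
  finite_pred (fun y => covers y (wt_tr u mu) /\ forall i, ~ bstep (mul_sr i y) y).
Proof.
apply: finite_sub finite_cover_pos => y [c nd].
have [b [bv [m [hb a hY ey]]]] := bstep_ascent hu (cover_bstep c).
have hv := in_WvM hu (in_Wv_refl hb).
have h i : pos_simple_im (Wmul u (refl b bv)) (mu + m *: bv) i.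
  by apply: NNPP => no; apply: (nd i); rewrite ey; exact: bstep_mul_sr_neg.
exists b, bv, m; split=> //.
  by have [//|nb] := root_sign hb; case: (no_descent_pos hb nb a h).
by move=> i; case: (h i) => [|[->]] //; exact: ltW.
Qed.

End FixedBottom.

(** Covers with a descent s_i are treated for each [i]. If x < x s_i, the only one is x s_i.
    Otherwise [cover_descent] relates them to covers of x s_i, for which the list of positive roots
    made negative is shorter. *)
Lemma finite_covers x : in_Wplus x -> finite_pred (fun y => covers y x).
Proof.
move=> /wt_trP[u [mu [hu hmu ->]]].
have [L] : finite_pred (fun g => pos_root g /\ (pairing mu g < 0 \/
    pairing mu g = 0 /\ pos_root (- actX u g))).
  apply: finite_sub (finiteU (Yplus_finite hmu) (finite_inversions hu)) => g [pg].
  by case=> [h|[_ /pos_rootP[_ h]]]; [left | right].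
have [n] := ubnP (size L); elim: n L u mu hu hmu => // n IH L u mu hu hmu sL hL.
have desc i : finite_pred (fun y => covers y (wt_tr u mu) /\ bstep (mul_sr i y) y).
  have [p|np] := classic (pos_simple_im u mu i).
    apply: finite_sub (finite1 (mul_sr i (wt_tr u mu))) => y [c yi].
    by rewrite (cover_next c (bstep_mul_sr hu hmu p) (lift_down (proj1 (proj1 c)) yi)).
  have hu' : in_Wv (Wmul u (sr i)) by apply: in_WvM => //; exact: in_Wv_sr.
  have hmu' : Yplus (actY (sr i) mu) by apply: Yplus_act => //; exact: in_Wv_sr.
  have iL : alpha i \in L.
    apply: hL; split; first exact: pos_simple.
    have [|ge] := ltP (pairing mu (alpha i)) 0; [by left | right].
    have [e|ne] := eqVneq (pairing mu (alpha i)) 0; last by case: np; left; lia.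
    split=> //; have [p|//] := root_sign (rt_act hu (rt_simple i)).
    by case: np; right.
  have L0 : (0 < size L)%N by case: (L) iL.
  have finite_pred' : finite_pred (fun y => covers y (mul_sr i (wt_tr u mu))).
    rewrite mul_sr_wt_tr.
    (* Duplicates are removed first so that [rem] deletes every copy of alpha_i; the remaining roots
       are moved by s_i. *)
    apply: (IH [seq actX (sr i) g | g <- rem (alpha i) (undup L)]) => //.
      by rewrite size_map size_rem ?mem_undup //; have := size_undup L; lia.
    move=> g [hg]; rewrite -pair_srr actXM => neg.
    have gi : g <> alpha i.
      move=> e; apply: np; move: neg; rewrite e actX_sr_simple pairingNr actXN opprK.
      by case=> [h|[h p]]; [left; lia | right; split=> //; lia].
    rewrite -(actX_srK i g) map_f // mem_rem_uniq ?undup_uniq // inE mem_undup.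
    apply/andP; split; first by apply/eqP; exact: sr_pos_neq.
    by apply: hL; split=> //; exact: sr_pos_root.
  have finr : finite_pred (
      fun y => exists2 z, covers z (mul_sr i (wt_tr u mu)) & y = mul_sr i z).
    by apply: finite_image finite_pred' => y h; exact: h.
  apply: finite_sub (finiteU (finite1 (mul_sr i (wt_tr u mu))) finr) => y [c yi].
  have [->|[_ c']] := cover_descent c yi; [by left | right].
  by exists (mul_sr i y); rewrite ?mul_srK.
have finI : finite_pred (fun y => exists2 i, i \in enum I &
    covers y (wt_tr u mu) /\ bstep (mul_sr i y) y).
  by apply: finite_bigU => i _.
apply: finite_sub (finiteU finI (finite_cover_no_descent hu hmu)) => y c.
have [[i h]|no] := classic (exists i, bstep (mul_sr i y) y).
  by left; exists i; rewrite ?mem_enum.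
by right; split=> // i h; apply: no; exists i.
Qed.

End AffineOrder.

Theorem theorem3p2 (D : KMRootDatum) (x : Et D) :
  in_Wplus x ->
  exists s : seq (Et D), forall y : Et D, covers y x -> y \in s.
Proof. exact: finite_covers. Qed.
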